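(* Let $m,n\in\mathbb{N}$. The decomposition $$\mathrm{SO}(m,n)=\rho(\mathrm{SO}(m))\,\beta(\mathbb{R}^{n\times m})\,\lambda(\mathrm{SO}(n))$$ is a bi-gyrodecomposition (with $H_L=\rho(\mathrm{SO}(m))$, $B=\beta(\mathbb{R}^{n\times m})$, $H_R=\lambda(\mathrm{SO}(n))$).
   Context: $\mathrm{SO}(m,n)$ denotes the group of linear transformations of $\mathbb{R}^{m+n}$ (as $(m+n)\times(m+n)$ real matrices) that leave invariant the pseudo-Euclidean inner product of signature $(m,n)$ (first $m$ coordinates with sign $+$, last $n$ with sign $-$) and that can be reached continuously from the identity transformation. $\mathrm{SO}(k)$ is the group of $k\times k$ special orthogonal matrices. $\mathbb{R}^{n\times m}$ is the space of $n\times m$ real matrices. Define $$\rho(O_m)=\begin{pmatrix}O_m&0\\0&I_n\end{pmatrix},\quad \lambda(O_n)=\begin{pmatrix}I_m&0\\0&O_n\end{pmatrix},\quad \beta(P)=\begin{pmatrix}\sqrt{I_m+P^{\mathsf t}P}&P^{\mathsf t}\\P&\sqrt{I_n+PP^{\mathsf t}}\end{pmatrix}$$ for $O_m\in\mathrm{SO}(m)$, $O_n\in\mathrm{SO}(n)$, $P\in\mathbb{R}^{n\times m}$, where square roots are the positive definite ones. Bi-transversal: a subset $B$ of a group $\Gamma$ is a bi-transversal of subgroups $H_L,H_R$ if every $g\in\Gamma$ can be written uniquely as $g=h_\ell b h_r$ with $h_\ell\in H_L$, $b\in B$, $h_r\in H_R$. Then for $b_1,b_2\in B$ there are unique $h_\ell(b_1,b_2)\in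 H_L$, $b_1\odot b_2\in B$, $h_r(b_1,b_2)\in H_R$ with $b_1b_2 = h_\ell(b_1,b_2)(b_1\odot b_2)h_r(b_1,b_2)$. Bi-gyrotransversal: a bi-transversal $B$ of $H_L,H_R$ such that $hBh^{-1}\subseteq B$ for all $h\in H_L$ and all $h\in H_R$, and $h_\ell h_r=h_rh_\ell$ for all $h_\ell\in H_L,h_r\in H_R$. Twisted subgroup: a subset $B$ of $\Gamma$ with $1\in B$; $b\in B\Rightarrow b^{-1}\in B$; and $a,b\in B\Rightarrow aba\in B$. Bi-gyrodecomposition: a decomposition $\Gamma=H_LBH_R$ such that $B$ is a bi-gyrotransversal of $H_L$ and $H_R$ in $\Gamma$, $B$ is a twisted subgroup of $\Gamma$, and $h_\ell(a,b)^{-1}=h_\ell(b,a)$, $h_r(a,b)^{-1}=h_r(b,a)$ for all $a,b\in B$. *)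

(* Defs.v *)
From HB Require Import structures.
From mathcomp Require Import all_boot all_order all_algebra.
From mathcomp Require Import all_classical all_reals all_analysis.
Set Implicit Arguments.
Unset Strict Implicit.
Unset Printing Implicit Defensive.
Import Order.TTheory GRing.Theory Num.Theory.
Import numFieldNormedType.Exports.
Local Open Scope classical_set_scope.
Local Open Scope ring_scope.

(* A group is presented by operations on an ambient type together with a      *)
(* carrier set on which they satisfy the group axioms. This lets a matrix     *)
(* group be a set of matrices, with membership in the group to be proved      *)
(* rather than imposed by a subtype.                                          *)
Record group_ops (T : choiceType) := GroupOps {
  gmul : T -> T -> T;
  gone : T;
  ginv : T -> T }.

Section BiGyrodecomposition.
Context (T : choiceType) (op : group_ops T).
Implicit Types (G H HL HR B : set T).

Local Notation "x ** y" := (gmul op x y) (at level 40, left associativity).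
Local Notation e := (gone op).
Local Notation inv := (ginv op).

Record is_group G : Prop := IsGroup {
  group_mul : forall x y, G x -> G y -> G (x ** y);
  group_one : G e;
  group_inv : forall x, G x -> G (inv x);
  group_mulA : forall x y z, G x -> G y -> G z -> x ** (y ** z) = x ** y ** z;
  group_mul1l : forall x, G x -> e ** x = x;
  group_mul1r : forall x, G x -> x ** e = x;
  group_mulVl : forall x, G x -> inv x ** x = e;
  group_mulVr : forall x, G x -> x ** inv x = e }.

Record is_subgroup G H : Prop := IsSubgroup {
  subgroup_sub : H `<=` G;
  subgroup_mul : forall x y, H x -> H y -> H (x ** y);
  subgroup_one : H e;
  subgroup_inv : forall x, H x -> H (inv x) }.

Definition bifactorization HL B HR (g : T) : set (T * T * T) :=
  [set t | [/\ HL t.1.1, B t.1.2, HR t.2 & g = t.1.1 ** t.1.2 ** t.2]].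

Record bitransversal G HL B HR : Prop := BiTransversal {
  bitrans_group : is_group G;
  bitrans_subl : is_subgroup G HL;
  bitrans_subr : is_subgroup G HR;
  bitrans_sub : B `<=` G;
  bitrans_uniq : forall g, G g -> exists! t, bifactorization HL B HR g t }.

(* The factors of [b1 ** b2]; the default [(e, e, e)] is irrelevant when [B]  *)
(* is a bitransversal and [b1], [b2] are in [B].                              *)
Definition bifactors HL B HR (b1 b2 : T) : T * T * T :=
  xget (e, e, e) (bifactorization HL B HR (b1 ** b2)).

Definition bi_hl HL B HR (b1 b2 : T) : T := (bifactors HL B HR b1 b2).1.1.
Definition bi_hr HL B HR (b1 b2 : T) : T := (bifactors HL B HR b1 b2).2.

Record bigyrotransversal G HL B HR : Prop := BiGyrotransversal {
  bigyro_trans : bitransversal G HL B HR;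
  bigyro_conjl : forall h b, HL h -> B b -> B (h ** b ** inv h);
  bigyro_conjr : forall h b, HR h -> B b -> B (h ** b ** inv h);
  bigyro_comm : forall hl hr, HL hl -> HR hr -> hl ** hr = hr ** hl }.

Record twisted_subgroup G B : Prop := TwistedSubgroup {
  twisted_sub : B `<=` G;
  twisted_one : B e;
  twisted_inv : forall b, B b -> B (inv b);
  twisted_mul : forall a b, B a -> B b -> B (a ** b ** a) }.

Record bigyrodecomposition G HL B HR : Prop := BiGyrodecomposition {
  bigyro_eq : G = [set g | exists hl b hr,
    [/\ HL hl, B b, HR hr & g = hl ** b ** hr]];
  bigyro_bigyrotrans : bigyrotransversal G HL B HR;
  bigyro_twisted : twisted_subgroup G B;
  bigyro_hl : forall a b, B a -> B b ->
    inv (bi_hl HL B HR a b) = bi_hl HL B HR b a;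
  bigyro_hr : forall a b, B a -> B b ->
    inv (bi_hr HL B HR a b) = bi_hr HL B HR b a }.

End BiGyrodecomposition.

Section PseudoOrthogonal.
Context (R : realType).

Definition mx_ops (k : nat) : group_ops 'M[R]_k :=
  GroupOps (@mulmx R k k k) 1%:M (@invmx R k).

Definition SOgroup (k : nat) : set 'M[R]_k :=
  [set A | A^T *m A = 1%:M /\ \det A = 1].

Definition pseudo_inner (m n : nat) (x y : 'cV[R]_(m + n)) : R :=
  \sum_(i < m) x (lshift n i) 0 * y (lshift n i) 0
  - \sum_(j < n) x (rshift m j) 0 * y (rshift m j) 0.

Definition pseudoO (m n : nat) : set 'M[R]_(m + n) :=
  [set A | forall x y : 'cV[R]_(m + n),
    pseudo_inner (A *m x) (A *m y) = pseudo_inner x y].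

(* [A] is reached from the identity by a continuous path inside [pseudoO].    *)
Definition pseudoSO (m n : nat) : set 'M[R]_(m + n) :=
  [set A | exists f : R -> 'M[R]_(m + n),
    [/\ {within `[0, 1]%classic, continuous f},
        forall t : R, 0 <= t <= 1 -> pseudoO (f t),
        f 0 = 1%:M & f 1 = A]].

Definition posdefmx (k : nat) (A : 'M[R]_k) : Prop :=
  A^T = A /\ forall x : 'cV[R]_k, x != 0 -> 0 < (x^T *m A *m x) 0 0.

(* The positive definite square root; 0 by default when there is none.        *)
Definition sqrtmx (k : nat) (A : 'M[R]_k) : 'M[R]_k :=
  xget 0 [set S | posdefmx S /\ S *m S = A].

Definition rho (m n : nat) (O : 'M[R]_m) : 'M[R]_(m + n) :=
  block_mx O 0 0 1%:M.

Definition lambda (m n : nat) (O : 'M[R]_n) : 'M[R]_(m + n) :=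
  block_mx 1%:M 0 0 O.

Definition beta (m n : nat) (P : 'M[R]_(n, m)) : 'M[R]_(m + n) :=
  block_mx (sqrtmx (1%:M + P^T *m P)) P^T P (sqrtmx (1%:M + P *m P^T)).

End PseudoOrthogonal.

Arguments mx_ops R k : clear implicits.
Arguments SOgroup R k : clear implicits.
Arguments pseudoO R m n : clear implicits.
Arguments pseudoSO R m n : clear implicits.
Arguments rho {R m} n O.
Arguments lambda {R} m {n} O.
Arguments beta {R m n} P.

(* Main.v *)
Require Import Defs.
From mathcomp Require Import all_boot all_order all_algebra.
From mathcomp Require Import all_classical all_reals all_analysis.
From mathcomp Require Import complex.
From mathcomp Require Import ring.

(** Everything rests on an intrinsic description of the middle factor: the
    matrices [beta P] are exactly the symmetric positive definite elements of
    the full pseudo-orthogonal group ([range_betaP]). Positive definiteness is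
    stable under inversion and under congruence [b |-> L^T b L], which gives
    at once that they form a twisted subgroup (for symmetric [a], [aba] is
    [a^T b a]) and that conjugation by an orthogonal pseudo-orthogonal matrix,
    in particular by [rho] and [lambda] of rotations, preserves them.

    One tool serves for all the algebra of square roots: the equation
    [S X + X T = 0] with [S] and [T] positive definite forces [X = 0]
    ([sylvester_eq0]). It gives uniqueness of the positive definite root and
    the relation [sqrt(1 + P^T P) P^T = P^T sqrt(1 + P P^T)], which says that
    [beta P] is pseudo-orthogonal. Roots exist because a real polynomial
    interpolating fourth roots at the eigenvalues, evaluated at the matrix, is
    a symmetric fourth root ([posdef_sqrt_exists]).

    The factors of [g = [A B; C D]] can be read off the blocks: [P = C], and
    the polar decompositions of [A] and [D] supply the two orthogonal factors,
    as [A^T A = 1 + C^T C] and [D D^T = 1 + C C^T]. These factors have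
    determinant 1 because [det A] and [det D] cannot vanish along a path from
    the identity ([pseudoSO_decomp]).

    The component of the identity is defined by paths, so membership of the
    three factors also needs paths. Rotations are products of an even number
    of reflections, and a product of two reflections is deformed to the
    identity by moving one mirror onto the other ([SOgroup_path]). For a
    positive definite pseudo-orthogonal [g], scaling its Cayley transform to 0
    gives a rational path to the identity ([pseudoSO_posdef]).

    Finally, if [ab = h c k] with [a], [b], [c] symmetric and [h], [k]
    orthogonal, transposing gives [ba = k^-1 c h^-1]. As [h] and [k] commute,
    this is [h^-1 c' k^-1] where [c'] is the conjugate of [c] by [h k^-1], and
    uniqueness of the factors yields the last two identities
    ([bifactors_swap]). *)

Set Implicit Arguments.
Unset Strict Implicit.
Unset Printing Implicit Defensive.
Import Order.TTheory GRing.Theory Num.Theory.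
Import numFieldNormedType.Exports.
Local Open Scope classical_set_scope.
Local Open Scope ring_scope.

(** * Positive definite matrices *)

Section PositiveDefinite.
Context {R : realType}.

Lemma col_sqnorm_ge0 k (x : 'cV[R]_k) : 0 <= (x^T *m x) 0 0.
Proof. by rewrite mxE sumr_ge0 // => i _; rewrite mxE -expr2 sqr_ge0. Qed.

Lemma col_sqnorm_eq0 k (x : 'cV[R]_k) : ((x^T *m x) 0 0 == 0) = (x == 0).
Proof.
rewrite mxE psumr_eq0; last by move=> i _; rewrite mxE -expr2 sqr_ge0.
apply/idP/eqP => [/allP h|->]; last by apply/allP => i _; rewrite /= !mxE mulr0 eqxx.
apply/colP => i; have := h i (mem_index_enum _).
by rewrite /= !mxE -expr2 sqrf_eq0 => /eqP.
Qed.

Lemma posdefmx1 k : posdefmx (1%:M : 'M[R]_k).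
Proof.
split=> [|x x0]; first by rewrite trmx1.
by rewrite mulmx1 lt_neqAle eq_sym col_sqnorm_eq0 x0 col_sqnorm_ge0.
Qed.

Lemma posdefmx_ge0 k (A : 'M[R]_k) (x : 'cV[R]_k) :
  posdefmx A -> 0 <= (x^T *m A *m x) 0 0.
Proof.
move=> [_ pA]; have [->|x0] := eqVneq x 0; first by rewrite mulmx0 mxE.
exact/ltW/pA.
Qed.

Lemma posdefmx_eq0 k (A : 'M[R]_k) (x : 'cV[R]_k) :
  posdefmx A -> (x^T *m A *m x) 0 0 = 0 -> x = 0.
Proof.
move=> [_ pA] h; apply/eqP; apply: contraTT isT => /pA.
by rewrite h ltxx.
Qed.

Lemma posdefmx_unit k (A : 'M[R]_k) : posdefmx A -> A \in unitmx.
Proof.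
move=> pA; rewrite -row_free_unit -kermx_eq0; apply/eqP/row_matrixP => i.
rewrite row0; apply: trmx_inj; rewrite trmx0.
apply: (posdefmx_eq0 pA).
by rewrite trmxK -row_mul mulmx_ker row0 mul0mx mxE.
Qed.

Lemma posdefmx_congr k (L A : 'M[R]_k) :
  L \in unitmx -> posdefmx A -> posdefmx (L^T *m A *m L).
Proof.
move=> uL [sA pA]; split=> [|x x0].
  by rewrite !trmx_mul trmxK sA mulmxA.
have Lx0 : L *m x != 0.
  by apply: contra x0 => /eqP h; rewrite -(mulKmx uL x) h mulmx0.
by have := pA _ Lx0; rewrite trmx_mul !mulmxA.
Qed.

Lemma posdefmx_inv k (A : 'M[R]_k) : posdefmx A -> posdefmx (invmx A).
Proof.
move=> pA; have uA := posdefmx_unit pA.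
have uV : invmx A \in unitmx by rewrite unitmx_inv.
have := posdefmx_congr uV pA.
by rewrite trmx_inv (proj1 pA) mulVmx // mul1mx.
Qed.

Lemma posdefmxD_scale k (a b : R) (A B : 'M[R]_k) :
  0 <= a -> 0 < b -> posdefmx A -> posdefmx B -> posdefmx (a *: A + b *: B).
Proof.
move=> a0 b0 pA [sB pB]; split=> [|x x0].
  by rewrite linearD /= !linearZ /= (proj1 pA) sB.
rewrite mulmxDr mulmxDl -!scalemxAr -!scalemxAl mxE ltr_wpDl //.
  by rewrite mxE mulr_ge0 // posdefmx_ge0.
by rewrite mxE mulr_gt0 // pB.
Qed.

Lemma posdefmx_gram m n (P : 'M[R]_(n, m)) : posdefmx (1%:M + P^T *m P).
Proof.
split=> [|x x0]; first by rewrite linearD /= trmx1 trmx_mul trmxK.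
rewrite mulmxDr mulmxDl mxE ltr_wpDr //; last exact: (posdefmx1 _).2.
by rewrite mulmxA -trmx_mul -mulmxA col_sqnorm_ge0.
Qed.

(** The trace of [X^T (S X + X T)] splits as [tr (X^T S X) + tr (X T X^T)], a
    sum of two nonnegative terms; so [tr (X^T S X) = 0], and each diagonal
    entry is the form of [S] at a column of [X]. *)
Lemma sylvester_eq0 m n (S : 'M[R]_m) (T : 'M[R]_n) (X : 'M[R]_(m, n)) :
  posdefmx S -> posdefmx T -> S *m X + X *m T = 0 -> X = 0.
Proof.
move=> pS pT e.
have diagE p q (A : 'M[R]_p) (Y : 'M[R]_(p, q)) j :
    (Y^T *m A *m Y) j j = ((col j Y)^T *m A *m col j Y) 0 0.
  rewrite tr_col -row_mul !mxE; apply: eq_bigr => l _.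
  by rewrite [in RHS]mxE [col j Y _ _]mxE.
have trge0 p q (A : 'M[R]_p) (Y : 'M[R]_(p, q)) :
    posdefmx A -> 0 <= \tr (Y^T *m A *m Y).
  by move=> pA; apply: sumr_ge0 => j _; rewrite diagE posdefmx_ge0.
have tr0 : \tr (X^T *m S *m X) = 0.
  apply/eqP; rewrite eq_le trge0 // andbT -oppr_ge0.
  have <- : \tr (X *m T *m X^T) = - \tr (X^T *m S *m X).
    apply/eqP; rewrite -addr_eq0 mxtrace_mulC mulmxA addrC -mulmxA.
    by rewrite -[X in _ + \tr X]mulmxA -linearD /= -mulmxDr e mulmx0
       mxtrace0.
  by have := trge0 _ _ _ X^T pT; rewrite trmxK.
apply/matrixP => i j; rewrite mxE.
suff /colP/(_ i) : col j X = 0 by rewrite !mxE.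
apply: (posdefmx_eq0 pS); rewrite -diagE.
have /eqP := tr0; rewrite psumr_eq0 => [/allP/(_ j (mem_index_enum _))/eqP //|].
by move=> l _; rewrite diagE posdefmx_ge0.
Qed.

(** [Y = S X - X T] satisfies [S Y + Y T = S S X - X T T = 0]. *)
Lemma posdef_sqrt_intertwine m n (S : 'M[R]_m) (T : 'M[R]_n)
    (X : 'M[R]_(m, n)) :
  posdefmx S -> posdefmx T -> S *m S *m X = X *m (T *m T) -> S *m X = X *m T.
Proof.
move=> pS pT e; apply/eqP; rewrite -subr_eq0; apply/eqP.
apply: (sylvester_eq0 pS pT).
by rewrite mulmxBr mulmxBl !mulmxA e !mulmxA subrKA subrr.
Qed.

End PositiveDefinite.

(** * Positive definite square roots *)

Section SquareRoot.
Context {R : realType}.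

Lemma interpolation (s : seq R) (f : R -> R) :
  exists p : {poly R}, {in s, forall x, p.[x] = f x}.
Proof.
elim: s => [|a s [p hp]]; first by exists 0.
have [as_|as_] := boolP (a \in s).
  by exists p => x; rewrite inE => /predU1P[->|]; apply: hp.
pose q := \prod_(x <- s) ('X - x%:P).
have qa : q.[a] != 0 by rewrite -rootE root_prod_XsubC.
exists (p + ((f a - p.[a]) / q.[a])%:P * q) => x.
rewrite inE !hornerE => /predU1P[->|xs]; first by rewrite divfK // addrC subrK.
have /eqP -> : q.[x] == 0 by rewrite -rootE root_prod_XsubC.
by rewrite mulr0 addr0 hp.
Qed.

Lemma horner_mx_sym k (A : 'M[R]_k.+1) (p : {poly R}) :
  A^T = A -> (horner_mx A p)^T = horner_mx A p.
Proof.
move=> sA; elim/poly_ind: p => [|p c IH]; first by rewrite rmorph0 trmx0.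
rewrite rmorphD rmorphM /= horner_mx_X horner_mx_C linearD /= tr_scalar_mx.
by rewrite -mulmxE trmx_mul IH sA (comm_mx_horner _ (comm_mx_refl A)).
Qed.

Lemma posdefmx_eigenvalue_gt0 k (A : 'M[R]_k) (a : R) :
  posdefmx A -> eigenvalue A a -> 0 < a.
Proof.
move=> pA /eigenvalueP[v vA v0].
have v0' : v^T != 0 by rewrite -trmx0 (inj_eq trmx_inj).
have := pA.2 _ v0'; rewrite trmxK vA -scalemxAl mxE.
have := (posdefmx1 _).2 _ v0'; rewrite trmxK mulmx1 => h.
by rewrite pmulr_lgt0.
Qed.

(** Passing to the complex numbers makes the spectral theorem for hermitian
    matrices available; the eigenvalues are real, hence are eigenvalues of the
    real matrix [A] and positive. The eigenvector matrix [P] may stay complex,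
    since only polynomials in [A] are formed from this decomposition. *)
Lemma posdefmx_spectral k (A : 'M[R]_k.+1) : posdefmx A ->
  exists (P : 'M[R[i]]_k.+1) (d : 'rV[R]_k.+1),
    [/\ P \in unitmx, forall i, 0 < d 0 i &
      map_mx (real_complex R) A
        = invmx P *m diag_mx (map_mx (real_complex R) d) *m P].
Proof.
move=> pA; set AC := map_mx _ A.
have hA : AC \is hermsymmx.
  apply/is_hermitianmxP; rewrite expr0 scale1r -map_trmx.
  rewrite /AC -map_mx_comp -{1}(proj1 pA) map_trmx.
  by apply/matrixP => i j; rewrite !mxE; apply/esym/conjc_real.
have /orthomx_spectralP := hermitian_normalmx hA.
set P := spectralmx AC; set d := spectral_diag AC => eA.
have uP : P \in unitmx := spectral_unit AC.
have dreal i : d 0 i = (complex.Re (d 0 i))%:C%C.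
  have /mxOverP/(_ 0 i) := hermitian_spectral_diag_real hA.
  by move=> dr; rewrite RRe_real.
have eig i : eigenvalue AC (d 0 i).
  apply/eigenvalueP; exists (row i P).
    rewrite -row_mul eA !mulmxA mulmxV // mul1mx mul_diag_mx.
    by apply/rowP => j; rewrite !mxE.
  apply/eqP => /(congr1 (mulmx^~ (invmx P))) /=.
  rewrite -row_mul mulmxV // mul0mx row1 => /rowP/(_ i)/eqP.
  by rewrite !mxE !eqxx oner_eq0.
exists P, (map_mx (@complex.Re R) d); split; first exact: uP.
  move=> i; rewrite mxE; apply: (posdefmx_eigenvalue_gt0 pA).
  have := eig i; rewrite dreal !eigenvalue_root_char /AC -map_char_poly.
  by rewrite fmorph_root.
suff <- : d = map_mx (real_complex R) (map_mx (@complex.Re R) d) by exact: eA.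
by apply/rowP => i; rewrite dreal !mxE.
Qed.

(** With [T = p(A)] a symmetric fourth root of [A], the root [T T = T^T 1 T] is
    positive definite by congruence; this is why fourth roots rather than
    square roots are interpolated. *)
Lemma posdef_sqrt_exists k (A : 'M[R]_k) : posdefmx A ->
  exists S, posdefmx S /\ S *m S = A.
Proof.
case: k A => [A pA|k A pA].
  by exists A; split=> //; apply/matrixP => -[].
have [P [d [uP d0 eA]]] := posdefmx_spectral pA.
have [p hp] := interpolation [seq d 0 i | i <- enum 'I_k.+1]
  (fun x => Num.sqrt (Num.sqrt x)).
pose T := horner_mx A p.
have T4 : T *m T *m (T *m T) = A.
  have {1}-> : T *m T *m (T *m T) = horner_mx A (p ^+ 4).
    by rewrite /T !mulmxE -!rmorphM; congr (horner_mx A _); ring.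
  apply: (@map_mx_inj _ _ (real_complex R)) => /=.
  rewrite map_horner_mx [in RHS]eA eA.
  rewrite (horner_mx_uconjC _ _ uP).
  rewrite horner_mx_diag; set d' := map_mx _ (map_mx _ d).
  suff -> : d' = map_mx (real_complex R) d by [].
  apply/rowP => i; rewrite !mxE horner_map /= !hornerE hp; last first.
    by apply/map_f; rewrite mem_enum.
  congr (_%:C)%C; rewrite (exprM _ 2 2) !sqr_sqrtr ?sqrtr_ge0 //.
  exact: ltW.
have uA := posdefmx_unit pA.
have uT : T \in unitmx.
  move: uA; rewrite -T4 -mulmxA unitmx_mul => /andP[] //.
exists (T *m T); split=> //.
have := posdefmx_congr uT (posdefmx1 k.+1).
by rewrite mulmx1 horner_mx_sym // (proj1 pA).
Qed.

Lemma posdef_sqrt_unique k (S T : 'M[R]_k) :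
  posdefmx S -> posdefmx T -> S *m S = T *m T -> S = T.
Proof.
move=> pS pT e; have := @posdef_sqrt_intertwine R _ _ S T 1%:M pS pT.
by rewrite !mulmx1 !mul1mx; apply.
Qed.

Lemma sqrtmxP k (A : 'M[R]_k) : posdefmx A ->
  posdefmx (sqrtmx A) /\ sqrtmx A *m sqrtmx A = A.
Proof.
move=> pA; have [S hS] := posdef_sqrt_exists pA.
by rewrite /sqrtmx; case: xgetP => [T -> //|/(_ S)/=].
Qed.

Lemma sqrtmx_eq k (S A : 'M[R]_k) : posdefmx S -> S *m S = A -> sqrtmx A = S.
Proof.
move=> pS SA; have pA : posdefmx A.
  have := posdefmx_congr (posdefmx_unit pS) (posdefmx1 k).
  by rewrite mulmx1 (proj1 pS) SA.
have [pT TT] := sqrtmxP pA.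
by apply: posdef_sqrt_unique => //; rewrite TT SA.
Qed.

Lemma posdefmx_det_gt0 k (A : 'M[R]_k) : posdefmx A -> 0 < \det A.
Proof.
move=> pA; have [S [pS <-]] := posdef_sqrt_exists pA.
have := posdefmx_unit pS; rewrite unitmxE unitfE => dS.
by rewrite det_mulmx -expr2 exprn_even_gt0.
Qed.

End SquareRoot.

(** * Limits of matrix-valued functions *)

Section MatrixLimits.
Context {R : realType} {T : Type} (F : set_system T) {FF : Filter F}.

Lemma cvg_mxP m n (f : T -> 'M[R]_(m, n)) (M : 'M[R]_(m, n)) :
  f t @[t --> F] --> M <-> forall i j, f t i j @[t --> F] --> M i j.
Proof.
split=> [h i j|h A [P PM sPA]].
  exact: (cvg_comp f (fun N : 'M[R]_(m, n) => N i j) h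
    (@coord_continuous _ _ _ i j M)).
have : \forall t \near F, forall i j, P i j (f t i j).
  by apply: filter_forall => i; apply: filter_forall => j; apply: h; apply: PM.
by apply: filterS => t ht; apply: sPA.
Qed.

Lemma cvg_addmx m n (f g : T -> 'M[R]_(m, n)) (M N : 'M[R]_(m, n)) :
  f t @[t --> F] --> M -> g t @[t --> F] --> N ->
  f t + g t @[t --> F] --> M + N.
Proof.
move=> /cvg_mxP hf /cvg_mxP hg; apply/cvg_mxP => i j.
under eq_fun do rewrite mxE.
rewrite mxE.
exact: cvgD.
Qed.

Lemma cvg_scalemx m n (a : T -> R) (g : T -> 'M[R]_(m, n)) (b : R)
    (N : 'M[R]_(m, n)) :
  a t @[t --> F] --> b -> g t @[t --> F] --> N ->
  a t *: g t @[t --> F] --> b *: N.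
Proof.
move=> hf /cvg_mxP hg; apply/cvg_mxP => i j.
under eq_fun do rewrite mxE.
rewrite mxE.
exact: cvgM.
Qed.

Lemma cvg_trmx m n (f : T -> 'M[R]_(m, n)) (M : 'M[R]_(m, n)) :
  f t @[t --> F] --> M -> (f t)^T @[t --> F] --> M^T.
Proof.
move=> /cvg_mxP hf; apply/cvg_mxP => i j.
under eq_fun do rewrite mxE.
rewrite mxE.
exact: hf.
Qed.

Lemma cvg_mulmx m n p (f : T -> 'M[R]_(m, n)) (g : T -> 'M[R]_(n, p))
    (M : 'M[R]_(m, n)) (N : 'M[R]_(n, p)) :
  f t @[t --> F] --> M -> g t @[t --> F] --> N ->
  f t *m g t @[t --> F] --> M *m N.
Proof.
move=> /cvg_mxP hf /cvg_mxP hg; apply/cvg_mxP => i j.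
rewrite mxE (_ : (fun t => _) = fun t => \sum_k f t i k * g t k j); last first.
  by apply/funext => t; rewrite mxE.
apply: cvg_big => [|k _]; first exact: add_continuous.
exact: cvgM.
Qed.

Lemma cvg_det n (f : T -> 'M[R]_n) (M : 'M[R]_n) :
  f t @[t --> F] --> M -> \det (f t) @[t --> F] --> \det M.
Proof.
move=> /cvg_mxP hf; rewrite /determinant.
apply: cvg_big => [|s _]; first exact: add_continuous.
apply: cvgM; first exact: cvg_cst.
by apply: cvg_big => [|i _]; first exact: mul_continuous.
Qed.

Lemma cvg_block_mx m1 m2 n1 n2
    (f : T -> 'M[R]_(m1, n1)) (g : T -> 'M[R]_(m1, n2))
    (h : T -> 'M[R]_(m2, n1)) (k : T -> 'M[R]_(m2, n2))
    (A : 'M[R]_(m1, n1)) (B : 'M[R]_(m1, n2))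
    (C : 'M[R]_(m2, n1)) (D : 'M[R]_(m2, n2)) :
  f t @[t --> F] --> A -> g t @[t --> F] --> B ->
  h t @[t --> F] --> C -> k t @[t --> F] --> D ->
  block_mx (f t) (g t) (h t) (k t) @[t --> F] --> block_mx A B C D.
Proof.
move=> /cvg_mxP hf /cvg_mxP hg /cvg_mxP hh /cvg_mxP hk; apply/cvg_mxP => i j.
case: (split_ordP i) => i' ->; case: (split_ordP j) => j' ->.
- by rewrite block_mxEul; under eq_fun do rewrite block_mxEul; exact: hf.
- by rewrite block_mxEur; under eq_fun do rewrite block_mxEur; exact: hg.
- by rewrite block_mxEdl; under eq_fun do rewrite block_mxEdl; exact: hh.
- by rewrite block_mxEdr; under eq_fun do rewrite block_mxEdr; exact: hk.
Qed.

Lemma cvg_ulsubmx m1 m2 n1 n2 (f : T -> 'M[R]_(m1 + m2, n1 + n2))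
    (M : 'M[R]_(m1 + m2, n1 + n2)) :
  f t @[t --> F] --> M -> ulsubmx (f t) @[t --> F] --> ulsubmx M.
Proof.
move=> /cvg_mxP hf; apply/cvg_mxP => i j.
under eq_fun do rewrite !mxE.
rewrite !mxE; exact: hf.
Qed.

Lemma cvg_drsubmx m1 m2 n1 n2 (f : T -> 'M[R]_(m1 + m2, n1 + n2))
    (M : 'M[R]_(m1 + m2, n1 + n2)) :
  f t @[t --> F] --> M -> drsubmx (f t) @[t --> F] --> drsubmx M.
Proof.
move=> /cvg_mxP hf; apply/cvg_mxP => i j.
under eq_fun do rewrite !mxE.
rewrite !mxE; exact: hf.
Qed.

Lemma cvg_invmx n (f : T -> 'M[R]_n) (M : 'M[R]_n) :
  M \in unitmx -> f t @[t --> F] --> M -> invmx (f t) @[t --> F] --> invmx M.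
Proof.
move=> uM hf; have dM : \det M != 0 by rewrite -unitfE -unitmxE.
have hd := cvg_det hf.
have unear : \forall t \near F, f t \in unitmx.
  have : \forall t \near F, \det (f t) != 0.
    exact: cvgr_neq0 hd dM.
  by apply: filterS => t; rewrite unitmxE unitfE.
have -> : invmx M = (\det M)^-1 *: \adj M by rewrite /invmx uM.
apply: (@cvg_trans _ ((\det (f t))^-1 *: \adj (f t) @[t --> F])).
  by apply: near_eq_cvg; apply: filterS unear => t ut; rewrite /invmx ut.
apply: cvg_scalemx; first exact: cvgV.
apply/cvg_mxP => i j; rewrite mxE; under eq_fun do rewrite mxE.
apply: cvgM; first exact: cvg_cst.
apply: cvg_det; apply/cvg_mxP => i' j'; rewrite !mxE.
under eq_fun do rewrite !mxE.
exact: (cvg_mxP f M).1.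
Qed.

End MatrixLimits.

(** * Paths starting at the identity *)

Section Paths.
Context {R : realType}.

(** For [K := pseudoO R m n] this unfolds to [pseudoSO R m n]; the same notion
    is needed for the orthogonal group. *)
Definition path_to k (K : set 'M[R]_k) : set 'M[R]_k :=
  [set A | exists f : R -> 'M[R]_k,
    [/\ {within `[0, 1]%classic, continuous f},
        forall t : R, 0 <= t <= 1 -> K (f t), f 0 = 1%:M & f 1 = A]].

Lemma path_to_sub k (K : set 'M[R]_k) : path_to K `<=` K.
Proof. by move=> _ [f [_ fK _ <-]]; apply: fK; rewrite ler01 lexx. Qed.

Lemma path_to_mul k (K : set 'M[R]_k) (A B : 'M[R]_k) :
  (forall A B, K A -> K B -> K (A *m B)) ->
  path_to K A -> path_to K B -> path_to K (A *m B).
Proof.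
move=> KM [f [fc fK f0 f1]] [g [gc gK g0 g1]]; exists (fun t => f t *m g t).
split=> [t|t t01||]; last 2 first.
- by rewrite f0 g0 mulmx1.
- by rewrite f1 g1.
- by apply: cvg_mulmx; [apply: fc | apply: gc].
- by apply: KM; [exact: fK | exact: gK].
Qed.

Lemma path_to_image k l (K : set 'M[R]_k) (L : set 'M[R]_l)
    (phi : 'M[R]_k -> 'M[R]_l) (A : 'M[R]_k) :
  continuous phi -> phi 1%:M = 1%:M -> (forall A, K A -> L (phi A)) ->
  path_to K A -> path_to L (phi A).
Proof.
move=> phic phi1 KL [f [fc fK f0 f1]]; exists (phi \o f); split.
- by move=> t; exact: (continuous_comp (fc t) (phic (f t))).
- by move=> t t01; apply: KL; exact: fK.
- by rewrite /= f0.
- by rewrite /= f1.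
Qed.

Lemma path_to_intro k (K : set 'M[R]_k) (f : R -> 'M[R]_k) :
  (forall t, 0 <= t <= 1 -> {for t, continuous f}) ->
  (forall t, 0 <= t <= 1 -> K (f t)) -> f 0 = 1%:M -> path_to K (f 1).
Proof.
move=> fc fK f0; exists f; split=> //.
apply: continuous_in_subspaceT => t; rewrite inE /= in_itv /= => t01.
exact: fc.
Qed.

(** By the intermediate value theorem, a change of sign of the determinant
    would produce a singular matrix on the path. *)
Lemma path_det_gt0 k (f : R -> 'M[R]_k) :
  {within `[0, 1]%classic, continuous f} ->
  (forall t : R, 0 <= t <= 1 -> f t \in unitmx) ->
  0 < \det (f 0) -> 0 < \det (f 1).
Proof.
move=> fc fu f0; rewrite ltNge; apply/negP => f1.
have dc : {within `[0, 1]%classic, continuous (fun t => \det (f t))}.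
  by move=> t; apply: cvg_det; exact: fc.
have [|c] := @IVT R (fun t => \det (f t)) 0 1 0 ler01 dc.
  by rewrite ge_min le_max f1 (ltW f0) orbT.
rewrite in_itv /= => c01 /eqP; apply/negP.
by rewrite -unitfE -unitmxE fu.
Qed.

End Paths.

(** * Rotations are connected to the identity *)

Section Reflections.
Context {R : realType}.

Definition orthogonalmx k : set 'M[R]_k := [set A | A^T *m A = 1%:M].

Definition reflmx k (u : 'cV[R]_k) : 'M[R]_k :=
  1%:M - (2 / (u^T *m u) 0 0) *: (u *m u^T).

Lemma reflmxN k (u : 'cV[R]_k) : reflmx (- u) = reflmx u.
Proof. by rewrite /reflmx [(- u)^T]linearN /= !mulmxN !mulNmx !opprK. Qed.

Lemma tr_reflmx k (u : 'cV[R]_k) : (reflmx u)^T = reflmx u.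
Proof. by rewrite /reflmx linearB /= linearZ /= trmx1 trmx_mul trmxK. Qed.

Lemma reflmx_apply k (u x : 'cV[R]_k) :
  reflmx u *m x = x - (2 / (u^T *m u) 0 0 * (u^T *m x) 0 0) *: u.
Proof.
rewrite /reflmx mulmxBl mul1mx -scalemxAl -mulmxA.
rewrite [in LHS](mx11_scalar (u^T *m x)).
by rewrite mul_mx_scalar scalerA.
Qed.

Lemma reflmxK k (u : 'cV[R]_k) : u != 0 -> reflmx u *m reflmx u = 1%:M.
Proof.
move=> u0; have q0 : (u^T *m u) 0 0 != 0 by rewrite col_sqnorm_eq0.
rewrite {2}/reflmx mulmxBr mulmx1 -scalemxAr mulmxA reflmx_apply divfK //.
by rewrite /reflmx mulmxBl -scalemxAl scalerBr scalerA; apply/matrixP => i j;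
  rewrite !mxE; ring.
Qed.

(** The mirror orthogonal to [x - y] exchanges two vectors of equal length:
    [2 (x - y).x = |x - y|^2], so the reflection subtracts [x - y] from [x]. *)
Lemma reflmx_swap k (x y : 'cV[R]_k) : x != y ->
  (x^T *m x) 0 0 = (y^T *m y) 0 0 -> reflmx (x - y) *m x = y.
Proof.
move=> xy e; rewrite reflmx_apply.
have q0 : ((x - y)^T *m (x - y)) 0 0 != 0 by rewrite col_sqnorm_eq0 subr_eq0.
have xyC : (x^T *m y) 0 0 = (y^T *m x) 0 0.
  by rewrite -[x^T *m y]trmxK trmx_mul trmxK mxE.
have subE (X Y : 'M[R]_1) : (X - Y) 0 0 = X 0 0 - Y 0 0 by rewrite !mxE.
have -> : 2 / ((x - y)^T *m (x - y)) 0 0 * ((x - y)^T *m x) 0 0 = 1.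
  rewrite mulrAC; apply: (canLR (mulfK q0)); rewrite mul1r.
  rewrite linearB /= !mulmxBl !mulmxBr; move: e xyC.
  by rewrite !subE => -> ->; ring.
by rewrite scale1r subKr.
Qed.

Lemma reflmx_fix k (u x : 'cV[R]_k) : (u^T *m x) 0 0 = 0 -> reflmx u *m x = x.
Proof. by move=> e; rewrite reflmx_apply e mulr0 scale0r subr0. Qed.

(** The determinant lemma [det (1 - c u u^T) = 1 - c u^T u], obtained from two
    block triangular factorizations of the same matrix. *)
Lemma det_reflmx k (u : 'cV[R]_k) : u != 0 -> \det (reflmx u) = -1.
Proof.
move=> u0; have q0 : (u^T *m u) 0 0 != 0 by rewrite col_sqnorm_eq0.
set c := 2 / (u^T *m u) 0 0.
have e : block_mx 1%:M 0 (c *: u) 1%:M *m block_mx (1%:M : 'M[R]_1) u^T 0 (reflmx u)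
    = block_mx 1%:M u^T 0 1%:M *m block_mx (- 1%:M) 0 (c *: u) 1%:M.
  rewrite !mulmx_block !mulmx1 !mul1mx !mulmx0 !mul0mx !addr0 !add0r.
  congr block_mx; last by rewrite -scalemxAl addrC subrK.
  rewrite -scalemxAr [in RHS](mx11_scalar (u^T *m u)) scale_scalar_mx /c divfK //.
  by apply/matrixP => i j; rewrite !ord1 !mxE eqxx; ring.
have /(congr1 determinant) := e.
rewrite !det_mulmx !det_lblock !det_ublock !det1 !mul1r !mulr1 => ->.
by rewrite -scaleN1r detZ det1 mulr1 expr1.
Qed.

Lemma orthogonalmxM k (A B : 'M[R]_k) :
  orthogonalmx A -> orthogonalmx B -> orthogonalmx (A *m B).
Proof.
move=> oA oB.
by rewrite /orthogonalmx /= trmx_mul mulmxA -(mulmxA B^T) oA mulmx1.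
Qed.

Lemma orthogonal_reflmx k (u : 'cV[R]_k) : u != 0 -> orthogonalmx (reflmx u).
Proof. by move=> u0; rewrite /orthogonalmx /= tr_reflmx reflmxK. Qed.

Definition reflprod k (s : seq 'cV[R]_k) : 'M[R]_k :=
  foldr (fun u A => reflmx u *m A) 1%:M s.

(** If [A] fixes the first [j] basis vectors, composing with the reflection
    that sends [A e_j] back to [e_j] keeps them fixed, because
    [A e_j - e_j] is orthogonal to them, and gains one more fixed vector. *)
Lemma orthogonal_reflprod k (A : 'M[R]_k) : orthogonalmx A ->
  exists s, all (fun u => u != 0) s /\ A = reflprod s.
Proof.
move=> oA.
suff H d : forall j, (j + d = k)%N -> forall A : 'M[R]_k, orthogonalmx A ->
    (forall i : 'I_k, (i < j)%N -> A *m delta_mx i 0 = delta_mx i 0 :> 'cV_k) ->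
    exists s, all (fun u => u != 0) s /\ A = reflprod s.
  by apply: (H k 0%N) => //.
elim: d => [|d IH] j jd {oA}A oA fixA.
  exists [::]; split=> //=; apply/matrixP => i l.
  have lj : (l < j)%N by rewrite -(addn0 j) jd.
  by have /colP/(_ i) := fixA l lj; rewrite -colE !mxE eqxx andbT.
have jk : (j < k)%N by rewrite -jd addnS ltnS leq_addr.
pose e : 'cV[R]_k := delta_mx (Ordinal jk) 0.
have jd' : (j.+1 + d = k)%N by rewrite addSnnS.
have isoA (x y : 'cV[R]_k) : (A *m x)^T *m (A *m y) = x^T *m y.
  by rewrite trmx_mul mulmxA -(mulmxA x^T) oA mulmx1.
have [Ae|Ae] := eqVneq (A *m e) e.
  apply: (IH _ jd' _ oA) => i.
  rewrite ltnS leq_eqVlt => /predU1P[ij|]; last exact: fixA.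
  by rewrite (_ : i = Ordinal jk) //; apply: val_inj.
set u := A *m e - e; have u0 : u != 0 by rewrite subr_eq0.
have [] := IH _ jd' (reflmx u *m A).
- exact: orthogonalmxM (orthogonal_reflmx u0) oA.
- move=> i; rewrite ltnS leq_eqVlt => /predU1P[ij|ij]; rewrite -mulmxA.
    rewrite (_ : i = Ordinal jk); last exact: val_inj.
    by apply: reflmx_swap => //; rewrite isoA.
  rewrite fixA //; apply: reflmx_fix.
  rewrite linearB /= mulmxBl -{1}(fixA _ ij) isoA subrr mxE //.
move=> s [s0 es]; exists (u :: s); split; first by rewrite /= u0.
by rewrite /= -es mulmxA reflmxK // mul1mx.
Qed.

(** The segment from [u] to [v] avoids 0 as soon as [u.v >= 0], which can be
    achieved by replacing [v] with [- v], leaving the reflection unchanged.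
    Moving the second mirror along it deforms [reflmx u *m reflmx v] to
    [reflmx u *m reflmx u = 1]. *)
Lemma path_to_reflmx2 k (u v : 'cV[R]_k) : u != 0 -> v != 0 ->
  path_to (@orthogonalmx k) (reflmx u *m reflmx v).
Proof.
move=> u0 v0; wlog uv : v v0 / 0 <= (u^T *m v) 0 0.
  move=> H; have [uv|/ltW uv] := leP 0 ((u^T *m v) 0 0); first exact: (H v v0 uv).
  by rewrite -(reflmxN v); apply: H; rewrite ?oppr_eq0 // mulmxN mxE oppr_ge0.
pose w (t : R) := (1 - t) *: u + t *: v.
have uu : 0 < (u^T *m u) 0 0.
  by rewrite lt_neqAle eq_sym col_sqnorm_eq0 u0 col_sqnorm_ge0.
have w0 t : 0 <= t <= 1 -> w t != 0.
  move=> /andP[t0 t1]; apply/eqP => wt.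
  have : (u^T *m w t) 0 0 = 0 by rewrite wt mulmx0 mxE.
  rewrite mulmxDr -!scalemxAr mxE [X in X + _]mxE [X in _ + X]mxE => /eqP.
  rewrite paddr_eq0 ?mulr_ge0 ?subr_ge0 // ?(ltW uu) //.
  rewrite mulf_eq0 (gt_eqF uu) orbF.
  rewrite subr_eq0 => /andP[/eqP t1' _].
  by move: wt; rewrite /w -t1' subrr scale0r add0r scale1r => /eqP; apply/negP.
have -> : reflmx v = reflmx (w 1) by rewrite /w subrr scale0r add0r scale1r.
apply: (@path_to_intro _ _ _ (fun t => reflmx u *m reflmx (w t))) => [t t01|t t01|].
- apply: cvg_mulmx; first exact: cvg_cst.
  have wc : w s @[s --> t] --> w t.
    apply: cvg_addmx; apply: cvg_scalemx; try exact: cvg_cst; last exact: cvg_id.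
    by apply: cvgB; [exact: cvg_cst | exact: cvg_id].
  apply: cvg_addmx; first exact: cvg_cst.
  under eq_fun do rewrite -scaleNr.
  rewrite -scaleNr; apply: cvg_scalemx; last by apply: cvg_mulmx => //; exact: cvg_trmx.
  apply: cvgN; apply: cvgM; first exact: cvg_cst.
  apply: cvgV; first by rewrite col_sqnorm_eq0 w0.
  by have /cvg_mxP : (w s)^T *m w s @[s --> t] --> (w t)^T *m w t
    by apply: cvg_mulmx => //; exact: cvg_trmx.
- by apply: orthogonalmxM; apply: orthogonal_reflmx => //; exact: w0.
- by rewrite /w subr0 scale0r addr0 scale1r reflmxK.
Qed.

Lemma path_to_reflprod k n (s : seq 'cV[R]_k) : size s = n.*2 ->
  all (fun u => u != 0) s -> path_to (@orthogonalmx k) (reflprod s).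
Proof.
elim: n s => [|n IH] [|u [|v s]] //=.
  move=> _ _; exists (fun=> 1%:M); split=> //.
    by move=> t; exact: cvg_cst.
  by move=> t _; rewrite /orthogonalmx /= trmx1 mulmx1.
move=> [sn] /and3P[u0 v0 s0]; rewrite mulmxA; apply: path_to_mul.
- exact: orthogonalmxM.
- exact: path_to_reflmx2.
- exact: IH.
Qed.

Lemma det_reflprod k (s : seq 'cV[R]_k) :
  all (fun u => u != 0) s -> \det (reflprod s) = (-1) ^+ size s.
Proof.
elim: s => [|u s IH] /=; first by rewrite det1 expr0.
by move=> /andP[u0 s0]; rewrite det_mulmx det_reflmx // IH // exprS.
Qed.

(** The determinant is -1 to the number of reflections, which is thus even. *)
Lemma SOgroup_path k (A : 'M[R]_k) :
  SOgroup R k A -> path_to (@orthogonalmx k) A.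
Proof.
move=> [oA dA]; have [s [s0 e]] := orthogonal_reflprod oA.
have := dA; rewrite e det_reflprod // -signr_odd.
have [|es _] := boolP (odd (size s)).
  by rewrite expr1 => _ /eqP; rewrite -subr_eq0 -opprD oppr_eq0 (pnatr_eq0 R 2).
by apply: (@path_to_reflprod _ (size s)./2) => //; rewrite even_halfK.
Qed.

End Reflections.

(** * Closure properties of the rotation groups *)

Section Orthogonal.
Context {R : realType}.

Lemma orthogonalmx_tr k (A : 'M[R]_k) : orthogonalmx A -> orthogonalmx A^T.
Proof. by rewrite /orthogonalmx /= trmxK => /mulmx1C. Qed.

Lemma orthogonalmx_inv k (A : 'M[R]_k) : orthogonalmx A -> invmx A = A^T.
Proof.
move=> oA; have [_ uA] := mulmx1_unit oA.
by rewrite -[LHS]mul1mx -oA mulmxK.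
Qed.

Lemma SOgroup1 k : SOgroup R k 1%:M.
Proof. by split; rewrite ?trmx1 ?mulmx1 ?det1. Qed.

Lemma SOgroupM k (A B : 'M[R]_k) :
  SOgroup R k A -> SOgroup R k B -> SOgroup R k (A *m B).
Proof.
move=> [oA dA] [oB dB]; split; last by rewrite det_mulmx dA dB mulr1.
exact: (orthogonalmxM oA oB).
Qed.

Lemma SOgroup_tr k (A : 'M[R]_k) : SOgroup R k A -> SOgroup R k A^T.
Proof.
by move=> [oA dA]; split; [exact: (orthogonalmx_tr oA) | rewrite det_tr].
Qed.

Lemma SOgroup_det_gt0 k (A : 'M[R]_k) :
  orthogonalmx A -> 0 < \det A -> SOgroup R k A.
Proof.
move=> oA dA; split=> //; have /(congr1 determinant) := oA.
rewrite det_mulmx det_tr det1 -expr2 => /eqP; rewrite sqrf_eq1.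
by case/predU1P => [//|/eqP d1]; move: dA; rewrite d1 ltr0N1.
Qed.

End Orthogonal.

(** * The pseudo-orthogonal group and its identity component *)

Section PseudoOrthogonalGroup.
Context {R : realType} (m n : nat).

Definition signmx : 'M[R]_(m + n) := block_mx 1%:M 0 0 (- 1%:M).

Lemma signmxK : signmx *m signmx = 1%:M.
Proof.
rewrite /signmx mulmx_block !mulmx0 !mul0mx mulmx1 mulmxN mulmx1 opprK.
by rewrite !addr0 add0r -scalar_mx_block.
Qed.

Lemma tr_signmx : signmx^T = signmx.
Proof. by rewrite /signmx tr_block_mx !trmx0 trmx1 linearN /= trmx1. Qed.

Lemma pseudo_innerE (x y : 'cV[R]_(m + n)) :
  pseudo_inner x y = (x^T *m signmx *m y) 0 0.
Proof.
rewrite -[in RHS](vsubmxK x) -[in RHS](vsubmxK y) /signmx tr_col_mx.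
rewrite mul_row_block !mulmx0 mulmxN !mulmx1 addr0 add0r mul_row_col mulNmx.
rewrite mxE [(- _ : 'M[R]_1) 0 0]mxE !mxE /pseudo_inner.
by congr (_ - _); apply: eq_bigr => i _; rewrite !mxE.
Qed.

Lemma pseudoOP (A : 'M[R]_(m + n)) :
  pseudoO R m n A <-> A^T *m signmx *m A = signmx.
Proof.
split=> [h|h x y]; last first.
  by rewrite !pseudo_innerE -[in RHS]h trmx_mul !mulmxA.
have entry (M : 'M[R]_(m + n)) i j :
    ((delta_mx i 0 : 'cV_(m + n))^T *m M *m (delta_mx j 0 : 'cV_(m + n))) 0 0
      = M i j.
  by rewrite trmx_delta -rowE -colE !mxE.
apply/matrixP => i j.
rewrite -entry -[RHS]entry -pseudo_innerE -h pseudo_innerE.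
by rewrite trmx_mul !mulmxA.
Qed.

Lemma pseudoO1 : pseudoO R m n 1%:M.
Proof. by apply/pseudoOP; rewrite trmx1 mul1mx mulmx1. Qed.

Lemma pseudoOM (A B : 'M[R]_(m + n)) :
  pseudoO R m n A -> pseudoO R m n B -> pseudoO R m n (A *m B).
Proof.
move=> /pseudoOP hA /pseudoOP hB; apply/pseudoOP.
by rewrite trmx_mul !mulmxA -(mulmxA B^T) -(mulmxA B^T) hA.
Qed.

Lemma pseudoO_mulV (A : 'M[R]_(m + n)) :
  pseudoO R m n A -> signmx *m A^T *m signmx *m A = 1%:M.
Proof. by move=> /pseudoOP hA; rewrite -!mulmxA (mulmxA A^T) hA signmxK. Qed.

Lemma pseudoO_unit (A : 'M[R]_(m + n)) : pseudoO R m n A -> A \in unitmx.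
Proof. by move=> /pseudoO_mulV /mulmx1_unit []. Qed.

Lemma pseudoO_inv (A : 'M[R]_(m + n)) :
  pseudoO R m n A -> invmx A = signmx *m A^T *m signmx.
Proof.
by move=> hA; rewrite -[LHS]mul1mx -(pseudoO_mulV hA) mulmxK // pseudoO_unit.
Qed.

(** [signmx A^T signmx] is a left inverse of the square matrix [A], hence also
    a right inverse. *)
Lemma pseudoO_tr (A : 'M[R]_(m + n)) : pseudoO R m n A -> pseudoO R m n A^T.
Proof.
move=> /pseudoO_mulV /mulmx1C h; apply/pseudoOP; rewrite trmxK.
have /(congr1 (mulmx^~ signmx)) := h.
by rewrite mul1mx -!mulmxA signmxK mulmx1 !mulmxA.
Qed.

Lemma pseudoO_sign : pseudoO R m n signmx.
Proof. by apply/pseudoOP; rewrite tr_signmx signmxK mul1mx. Qed.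

Lemma pseudoSO_sub : pseudoSO R m n `<=` pseudoO R m n.
Proof. exact: path_to_sub. Qed.

Lemma pseudoSO1 : pseudoSO R m n 1%:M.
Proof.
exists (fun=> 1%:M); split=> //; first by move=> t; exact: cvg_cst.
by move=> t _; exact: pseudoO1.
Qed.

Lemma pseudoSOM (A B : 'M[R]_(m + n)) :
  pseudoSO R m n A -> pseudoSO R m n B -> pseudoSO R m n (A *m B).
Proof. by apply: path_to_mul; exact: pseudoOM. Qed.

Lemma pseudoSO_inv (A : 'M[R]_(m + n)) :
  pseudoSO R m n A -> pseudoSO R m n (invmx A).
Proof.
move=> hA; rewrite pseudoO_inv; last exact: pseudoSO_sub.
apply: (path_to_image (phi := fun A => signmx *m A^T *m signmx) _ _ _ hA).
- move=> M; have hM : N @[N --> M] --> M by exact: cvg_id.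
  exact: (cvg_mulmx (cvg_mulmx (cvg_cst signmx) (cvg_trmx hM)) (cvg_cst signmx)).
- by rewrite trmx1 mulmx1 signmxK.
- move=> M hM; do 2?apply: pseudoOM; try exact: pseudoO_sign.
  exact: pseudoO_tr.
Qed.

Lemma pseudoSO_group : is_group (mx_ops R (m + n)) (pseudoSO R m n).
Proof.
split=> /=.
- exact: pseudoSOM.
- exact: pseudoSO1.
- exact: pseudoSO_inv.
- by move=> x y z _ _ _; exact: mulmxA.
- by move=> x _; exact: mul1mx.
- by move=> x _; exact: mulmx1.
- by move=> x /pseudoSO_sub /pseudoO_unit; exact: mulVmx.
- by move=> x /pseudoSO_sub /pseudoO_unit; exact: mulmxV.
Qed.

Lemma pseudoO_blocks (A : 'M[R]_m) (B : 'M[R]_(m, n)) (C : 'M[R]_(n, m))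
    (D : 'M[R]_n) :
  pseudoO R m n (block_mx A B C D) <->
  [/\ A^T *m A = 1%:M + C^T *m C, A^T *m B = C^T *m D &
      D^T *m D = 1%:M + B^T *m B].
Proof.
rewrite pseudoOP /signmx tr_block_mx !mulmx_block !mulmx0 !mulmxN !mulmx1.
rewrite !addr0 !add0r !mulNmx; split.
  move=> /eq_block_mx[eA eB _ eD]; split; first by rewrite -eA subrK.
    by apply/eqP; rewrite -subr_eq0 eB.
  by rewrite -[1%:M]opprK -eD opprB subrK.
move=> [-> eB ->]; rewrite eB subrr addrK opprD addrCA subrr addr0.
have := congr1 trmx eB; rewrite !trmx_mul !trmxK => ->.
by rewrite subrr.
Qed.

Lemma pseudoO_rho (O : 'M[R]_m) : orthogonalmx O -> pseudoO R m n (rho n O).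
Proof.
move=> oO; apply/pseudoO_blocks.
by rewrite !trmx0 !mulmx0 !mul0mx trmx1 mulmx1 !addr0; split.
Qed.

Lemma pseudoO_lambda (O : 'M[R]_n) : orthogonalmx O -> pseudoO R m n (lambda m O).
Proof.
move=> oO; apply/pseudoO_blocks.
by rewrite !trmx0 !mulmx0 !mul0mx trmx1 mulmx1 !addr0; split.
Qed.

Lemma rhoM (A B : 'M[R]_m) : rho n (A *m B) = rho n A *m rho n B.
Proof. by rewrite /rho mulmx_block !mulmx0 !mul0mx mulmx1 !addr0 add0r. Qed.

Lemma lambdaM (A B : 'M[R]_n) : lambda m (A *m B) = lambda m A *m lambda m B.
Proof.
by rewrite /lambda mulmx_block !mulmx0 !mul0mx mulmx1 !addr0 !add0r.
Qed.

Lemma rho1 : rho n (1%:M : 'M[R]_m) = 1%:M.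
Proof. by rewrite /rho -scalar_mx_block. Qed.

Lemma lambda1 : lambda m (1%:M : 'M[R]_n) = 1%:M.
Proof. by rewrite /lambda -scalar_mx_block. Qed.

Lemma tr_rho (A : 'M[R]_m) : (rho n A)^T = rho n A^T.
Proof. by rewrite /rho tr_block_mx !trmx0 trmx1. Qed.

Lemma tr_lambda (A : 'M[R]_n) : (lambda m A)^T = lambda m A^T.
Proof. by rewrite /lambda tr_block_mx !trmx0 trmx1. Qed.

Lemma rho_lambdaC (A : 'M[R]_m) (B : 'M[R]_n) :
  rho n A *m lambda m B = lambda m B *m rho n A.
Proof.
by rewrite /rho /lambda !mulmx_block !mulmx0 !mul0mx !mulmx1 !mul1mx !addr0.
Qed.

Lemma orthogonalmx_rho (O : 'M[R]_m) : orthogonalmx O -> orthogonalmx (rho n O).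
Proof. by rewrite /orthogonalmx /= tr_rho -rhoM => ->; exact: rho1. Qed.

Lemma orthogonalmx_lambda (O : 'M[R]_n) :
  orthogonalmx O -> orthogonalmx (lambda m O).
Proof. by rewrite /orthogonalmx /= tr_lambda -lambdaM => ->; exact: lambda1. Qed.

Lemma pseudoSO_rho (O : 'M[R]_m) : SOgroup R m O -> pseudoSO R m n (rho n O).
Proof.
move=> /SOgroup_path; apply: path_to_image; last exact: pseudoO_rho.
  move=> M; have hM : N @[N --> M] --> M by exact: cvg_id.
  exact: (cvg_block_mx hM (cvg_cst _) (cvg_cst _) (cvg_cst _)).
exact: rho1.
Qed.

Lemma pseudoSO_lambda (O : 'M[R]_n) : SOgroup R n O -> pseudoSO R m n (lambda m O).
Proof.
move=> /SOgroup_path; apply: path_to_image; last exact: pseudoO_lambda.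
  move=> M; have hM : N @[N --> M] --> M by exact: cvg_id.
  exact: (cvg_block_mx (cvg_cst _) (cvg_cst _) (cvg_cst _) hM).
exact: lambda1.
Qed.

Lemma rho_subgroup :
  is_subgroup (mx_ops R (m + n)) (pseudoSO R m n) (rho n @` SOgroup R m).
Proof.
split=> /=.
- by move=> _ [U hU <-]; exact: pseudoSO_rho.
- move=> _ _ [U hU <-] [V hV <-].
  by exists (U *m V); [exact: SOgroupM | exact: rhoM].
- by exists 1%:M; [exact: SOgroup1 | exact: rho1].
- move=> _ [U hU <-]; exists U^T; first exact: SOgroup_tr.
  by rewrite orthogonalmx_inv ?tr_rho //; apply: orthogonalmx_rho; exact: hU.1.
Qed.

Lemma lambda_subgroup :
  is_subgroup (mx_ops R (m + n)) (pseudoSO R m n) (lambda m @` SOgroup R n).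
Proof.
split=> /=.
- by move=> _ [U hU <-]; exact: pseudoSO_lambda.
- move=> _ _ [U hU <-] [V hV <-].
  by exists (U *m V); [exact: SOgroupM | exact: lambdaM].
- by exists 1%:M; [exact: SOgroup1 | exact: lambda1].
- move=> _ [U hU <-]; exists U^T; first exact: SOgroup_tr.
  by rewrite orthogonalmx_inv ?tr_lambda //; apply: orthogonalmx_lambda; exact: hU.1.
Qed.

End PseudoOrthogonalGroup.

(** * Boosts and the decomposition *)

Section Boosts.
Context {R : realType} (m n : nat).

Local Notation sqL P := (sqrtmx (1%:M + P^T *m P)).
Local Notation sqR P := (sqrtmx (1%:M + P *m P^T)).

Lemma sqL_posdef (P : 'M[R]_(n, m)) : posdefmx (sqL P).
Proof. exact: (sqrtmxP (posdefmx_gram P)).1. Qed.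

Lemma sqL_sq (P : 'M[R]_(n, m)) : sqL P *m sqL P = 1%:M + P^T *m P.
Proof. exact: (sqrtmxP (posdefmx_gram P)).2. Qed.

Lemma sqR_posdef (P : 'M[R]_(n, m)) : posdefmx (sqR P).
Proof. by have := posdefmx_gram P^T; rewrite trmxK => /sqrtmxP[]. Qed.

Lemma sqR_sq (P : 'M[R]_(n, m)) : sqR P *m sqR P = 1%:M + P *m P^T.
Proof. by have := posdefmx_gram P^T; rewrite trmxK => /sqrtmxP[]. Qed.

Lemma sqL_sqR (P : 'M[R]_(n, m)) : sqL P *m P^T = P^T *m sqR P.
Proof.
apply: posdef_sqrt_intertwine; [exact: sqL_posdef | exact: sqR_posdef |].
by rewrite sqL_sq sqR_sq mulmxDl mulmxDr mul1mx mulmx1 mulmxA.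
Qed.

Lemma pseudoO_beta (P : 'M[R]_(n, m)) : pseudoO R m n (beta P).
Proof.
apply/pseudoO_blocks; rewrite (sqL_posdef P).1 (sqR_posdef P).1 trmxK.
by rewrite sqL_sq sqR_sq sqL_sqR.
Qed.

Lemma posdefmx_block_diag (A : 'M[R]_m) (D : 'M[R]_n) :
  posdefmx A -> posdefmx D -> posdefmx (block_mx A 0 0 D).
Proof.
move=> pA pD; split=> [|x x0].
  by rewrite tr_block_mx !trmx0 pA.1 pD.1.
rewrite -(vsubmxK x) tr_col_mx mul_row_block !mulmx0 addr0 add0r mul_row_col.
rewrite mxE; have [u0|u0] := eqVneq (usubmx x) 0; last first.
  by apply: ltr_wpDr; [exact: posdefmx_ge0 | exact: pA.2].
apply: ltr_wpDl; first exact: posdefmx_ge0.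
apply: pD.2; apply: contra x0 => /eqP d0.
by rewrite -(vsubmxK x) u0 d0 col_mx0.
Qed.

(** Block elimination: [beta P = L^T diag(sqL P ^-1, sqR P) L] with [L] lower
    unitriangular. The Schur complement
    [sqL P - P^T (sqR P)^-1 P] equals [(sqL P)^-1] by the intertwining relation
    together with [sqL P ^2 = 1 + P^T P]. *)
Lemma posdefmx_beta (P : 'M[R]_(n, m)) : posdefmx (beta P).
Proof.
have pL := sqL_posdef P; have pR := sqR_posdef P.
have uL := posdefmx_unit pL; have uR := posdefmx_unit pR.
pose L : 'M[R]_(m + n) := block_mx 1%:M 0 (invmx (sqR P) *m P) 1%:M.
have -> : beta P = L^T *m block_mx (invmx (sqL P)) 0 0 (sqR P) *m L.
  rewrite /L tr_block_mx !trmx0 !trmx1 trmx_mul trmx_inv pR.1 !mulmx_block.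
  rewrite !mulmx0 !mul0mx !mul1mx !mulmx1 !addr0 !add0r mulmxKV // mulKVmx //.
  congr block_mx; apply: (can_inj (mulKmx uL)).
  rewrite mulmxDr mulmxV // sqL_sq mulmxA mulmxA sqL_sqR.
  by rewrite -(mulmxA P^T) mulmxV // mulmx1.
apply: posdefmx_congr; last first.
  by apply: posdefmx_block_diag => //; exact: posdefmx_inv.
by rewrite unitmxE det_lblock !det1 mulr1 unitr1.
Qed.

Lemma posdefmx_ulblock (A : 'M[R]_m) (B : 'M[R]_(m, n)) (C : 'M[R]_(n, m))
    (D : 'M[R]_n) :
  posdefmx (block_mx A B C D) -> posdefmx A.
Proof.
move=> [+ p]; rewrite tr_block_mx => /eq_block_mx[sA _ _ _]; split=> // x x0.
have := p (col_mx x 0); rewrite col_mx_eq0 (negbTE x0) => /(_ isT).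
by rewrite tr_col_mx mul_row_block !trmx0 !mul0mx !addr0 mul_row_col mulmx0 addr0.
Qed.

Lemma posdefmx_drblock (A : 'M[R]_m) (B : 'M[R]_(m, n)) (C : 'M[R]_(n, m))
    (D : 'M[R]_n) :
  posdefmx (block_mx A B C D) -> posdefmx D.
Proof.
move=> [+ p]; rewrite tr_block_mx => /eq_block_mx[_ _ _ sD]; split=> // x x0.
have := p (col_mx 0 x); rewrite col_mx_eq0 (negbTE x0) andbF => /(_ isT).
by rewrite tr_col_mx mul_row_block !trmx0 !mul0mx !add0r mul_row_col mulmx0 add0r.
Qed.

(** For a symmetric pseudo-orthogonal [[A B; C D]] the block relations become
    [A A = 1 + C^T C] and [D D = 1 + C C^T]; positive definiteness of [g]
    passes to [A] and [D], which are therefore the required square roots. *)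
Lemma range_betaP (g : 'M[R]_(m + n)) :
  range beta g <-> pseudoO R m n g /\ posdefmx g.
Proof.
split=> [[P _ <-]|[]]; first by split; [exact: pseudoO_beta | exact: posdefmx_beta].
rewrite -(submxK g); set A := ulsubmx g; set B := ursubmx g.
set C := dlsubmx g; set D := drsubmx g.
move=> /pseudoO_blocks [eA _ eD] pg.
have [_ _ CB _] : [/\ A^T = A, C^T = B, B^T = C & D^T = D].
  by have := pg.1; rewrite tr_block_mx => /eq_block_mx.
have pA := posdefmx_ulblock pg; have pD := posdefmx_drblock pg.
exists C => //; rewrite /beta; congr block_mx.
- by apply: sqrtmx_eq => //; rewrite -eA pA.1.
- by rewrite -CB trmxK.
- by apply: sqrtmx_eq => //; rewrite -CB trmxK -eD pD.1.
Qed.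

(** The Cayley transform [X = (g - 1)(g + 1)^-1] lies in the Lie algebra, and
    the path is [t |-> (1 + tX)(1 - tX)^-1], written with the common factor
    [(g + 1)^-1] cancelled so that only positive definite matrices are
    inverted. *)
Lemma pseudoSO_posdef (g : 'M[R]_(m + n)) :
  pseudoO R m n g -> posdefmx g -> pseudoSO R m n g.
Proof.
move=> Og pg.
pose N (t : R) : 'M[R]_(m + n) := (1 - t) *: 1%:M + (1 + t) *: g.
pose M (t : R) : 'M[R]_(m + n) := (1 - t) *: g + (1 + t) *: 1%:M.
have pM t : 0 <= t <= 1 -> posdefmx (M t).
  move=> /andP[t0 t1]; apply: posdefmxD_scale => //; last exact: posdefmx1.
    by rewrite subr_ge0.
  by rewrite ltr_wpDr.
have pN t : 0 <= t <= 1 -> posdefmx (N t).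
  move=> /andP[t0 t1]; apply: posdefmxD_scale => //; last exact: posdefmx1.
    by rewrite subr_ge0.
  by rewrite ltr_wpDr.
have cN t : N s @[s --> t] --> N t.
  apply: cvg_addmx; apply: cvg_scalemx; try exact: cvg_cst.
    by apply: cvgB; [exact: cvg_cst | exact: cvg_id].
  by apply: cvgD; [exact: cvg_cst | exact: cvg_id].
have cM t : M s @[s --> t] --> M t.
  apply: cvg_addmx; apply: cvg_scalemx; try exact: cvg_cst.
    by apply: cvgB; [exact: cvg_cst | exact: cvg_id].
  by apply: cvgD; [exact: cvg_cst | exact: cvg_id].
have two0 : 1 + 1 != 0 :> R by rewrite (pnatr_eq0 R 2).
have -> : g = N 1 *m invmx (M 1).
  rewrite /N /M subrr !scale0r !add0r invmxZ.
    by rewrite invmx1 -scalemxAr mulmx1 scalerA mulVf // scale1r.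
  by rewrite unitmxZ ?unitmx1 // unitfE.
apply: (@path_to_intro _ _ _ (fun t => N t *m invmx (M t))) => [t t01|t t01|].
- exact: (cvg_mulmx (cN t) (cvg_invmx (posdefmx_unit (pM _ t01)) (cM t))).
- have uM := posdefmx_unit (pM _ t01); have sM := (pM _ t01).1.
  have sN := (pN _ t01).1.
  (* With J = signmx, N = a + b g, M = b + a g, both sides are
     (a^2 + b^2) J + a b (g J + J g), because g J g = J. *)
  have NJN : (N t)^T *m signmx m n *m N t = M t *m signmx m n *m M t.
    have /pseudoOP := Og; rewrite pg.1 sN /N /M => gJg.
    rewrite !(mulmxDl, mulmxDr) -!scalemxAl -!scalemxAr !mul1mx.
    rewrite !mulmx1 gJg.
    by apply/matrixP => i j; rewrite !mxE; ring.
  apply/pseudoOP; rewrite trmx_mul trmx_inv sM !mulmxA.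
  rewrite -(mulmxA (invmx _)) -(mulmxA (invmx _)) NJN !mulmxA mulVmx // mul1mx.
  by rewrite mulmxK.
- rewrite /N /M addr0 subr0 [1 *: _ + _]addrC mulmxV //.
  have := pM 0; rewrite /M addr0 subr0 => h.
  by apply/posdefmx_unit/h; rewrite lexx ler01.
Qed.

Lemma range_beta_sub : range (@beta R m n) `<=` pseudoSO R m n.
Proof. by move=> g /range_betaP[]; exact: pseudoSO_posdef. Qed.

Lemma range_beta_conj (h b : 'M[R]_(m + n)) :
  orthogonalmx h -> pseudoO R m n h -> range beta b -> range beta (h *m b *m h^T).
Proof.
move=> oh Oh /range_betaP[Ob pb]; apply/range_betaP; split.
  by do 2?apply: pseudoOM => //; exact: pseudoO_tr.
rewrite -{1}[h]trmxK; apply: posdefmx_congr => //.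
by rewrite unitmx_tr pseudoO_unit.
Qed.

Lemma rho_beta_lambda (A : 'M[R]_m) (P : 'M[R]_(n, m)) (D : 'M[R]_n) :
  rho n A *m beta P *m lambda m D
    = block_mx (A *m sqL P) (A *m P^T *m D) P (sqR P *m D).
Proof.
rewrite /rho /beta /lambda !mulmx_block !mulmx0 !mul0mx !mulmx1 !mul1mx.
by rewrite !addr0 !add0r.
Qed.

Lemma rho_beta_lambda_inj (A A' : 'M[R]_m) (P P' : 'M[R]_(n, m)) (D D' : 'M[R]_n) :
  rho n A *m beta P *m lambda m D = rho n A' *m beta P' *m lambda m D' ->
  [/\ A = A', P = P' & D = D'].
Proof.
rewrite !rho_beta_lambda => /eq_block_mx[eA _ eP eD]; subst P'; split=> //.
  exact: (can_inj (mulmxK (posdefmx_unit (sqL_posdef P))) eA).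
exact: (can_inj (mulKmx (posdefmx_unit (sqR_posdef P))) eD).
Qed.

Lemma pseudoO_ul_gram (g : 'M[R]_(m + n)) : pseudoO R m n g ->
  (ulsubmx g)^T *m ulsubmx g = 1%:M + (dlsubmx g)^T *m dlsubmx g.
Proof. by rewrite -{1}(submxK g) => /pseudoO_blocks[]. Qed.

Lemma pseudoO_dr_gram (g : 'M[R]_(m + n)) : pseudoO R m n g ->
  drsubmx g *m (drsubmx g)^T = 1%:M + dlsubmx g *m (dlsubmx g)^T.
Proof.
move=> /pseudoO_tr; rewrite -{1}(submxK g) tr_block_mx => /pseudoO_blocks[_ _].
by rewrite !trmxK.
Qed.

(** The block stays invertible along the path since its Gram matrix is
    [1 + C^T C]. *)
Lemma pseudoSO_ul_det_gt0 (g : 'M[R]_(m + n)) :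
  pseudoSO R m n g -> 0 < \det (ulsubmx g).
Proof.
move=> [f [fc fO f0 <-]].
apply: (@path_det_gt0 _ _ (fun t => ulsubmx (f t))) => [t|t t01|].
- exact: (cvg_ulsubmx (fc t)).
- have := posdefmx_unit (posdefmx_gram (dlsubmx (f t))).
  by rewrite -pseudoO_ul_gram ?unitmx_mul; [case/andP | exact: fO].
- by rewrite f0 (@scalar_mx_block _ m n) block_mxKul det1.
Qed.

Lemma pseudoSO_dr_det_gt0 (g : 'M[R]_(m + n)) :
  pseudoSO R m n g -> 0 < \det (drsubmx g).
Proof.
move=> [f [fc fO f0 <-]].
apply: (@path_det_gt0 _ _ (fun t => drsubmx (f t))) => [t|t t01|].
- exact: (cvg_drsubmx (fc t)).
- have := posdefmx_unit (posdefmx_gram (dlsubmx (f t))^T).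
  by rewrite trmxK -pseudoO_dr_gram ?unitmx_mul; [case/andP | exact: fO].
- by rewrite f0 (@scalar_mx_block _ m n) block_mxKdr det1.
Qed.

(** The formulas for [A] and [D] are forced by [rho_beta_lambda]; three of the
    blocks then agree by construction. For the upper right one, multiply by
    [A^T]: [A^T ur = S^-1 ul^T ur = S^-1 P^T dr = S^-1 P^T T D = P^T D]. *)
Lemma pseudoSO_decomp (g : 'M[R]_(m + n)) : pseudoSO R m n g ->
  exists A P D, [/\ SOgroup R m A, SOgroup R n D &
    g = rho n A *m beta P *m lambda m D].
Proof.
move=> hg; have Og := pseudoSO_sub hg.
set P := dlsubmx g; pose S := sqL P; pose T := sqR P.
have pS : posdefmx S := sqL_posdef P; have pT : posdefmx T := sqR_posdef P.
have uS := posdefmx_unit pS; have uT := posdefmx_unit pT.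
have sS := pS.1; have sT := pT.1.
pose A := ulsubmx g *m invmx S; pose D := invmx T *m drsubmx g.
have oA : orthogonalmx A.
  rewrite /orthogonalmx /= /A trmx_mul trmx_inv sS mulmxA -(mulmxA (invmx S)).
  by rewrite pseudoO_ul_gram // -sqL_sq -/S mulmxA mulVmx // mul1mx mulmxV.
have oDt : D *m D^T = 1%:M.
  rewrite /D trmx_mul trmx_inv sT mulmxA -(mulmxA (invmx T)).
  by rewrite pseudoO_dr_gram // -sqR_sq -/T mulmxA mulVmx // mul1mx mulmxV.
have oD : orthogonalmx D by exact: mulmx1C.
exists A, P, D; split.
- apply: SOgroup_det_gt0 => //; rewrite det_mulmx mulr_gt0 ?pseudoSO_ul_det_gt0 //.
  exact/posdefmx_det_gt0/posdefmx_inv.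
- apply: SOgroup_det_gt0 => //; rewrite det_mulmx mulr_gt0 ?pseudoSO_dr_det_gt0 //.
  exact/posdefmx_det_gt0/posdefmx_inv.
rewrite rho_beta_lambda -[LHS]submxK -/S -/T mulmxKV // mulKVmx //.
congr block_mx.
have eB : (ulsubmx g)^T *m ursubmx g = P^T *m drsubmx g.
  by move: Og; rewrite -{1}(submxK g) => /pseudoO_blocks[].
have AB : A^T *m ursubmx g = P^T *m D.
  rewrite /A trmx_mul trmx_inv sS -mulmxA eB.
  apply: (can_inj (mulKmx uS)); rewrite mulKVmx // mulmxA sqL_sqR -mulmxA.
  by rewrite mulKVmx.
by rewrite -mulmxA -AB mulmxA (mulmx1C oA) mul1mx.
Qed.

End Boosts.

(** * The bi-gyrodecomposition *)

Section Assembly.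
Context {R : realType} (m n : nat).

Local Notation G := (pseudoSO R m n).
Local Notation HL := (rho n @` SOgroup R m).
Local Notation HR := (lambda m @` SOgroup R n).
Local Notation B := (range (@beta R m n)).
Local Notation op := (mx_ops R (m + n)).

Lemma pseudoSO_bitransversal : bitransversal op G HL B HR.
Proof.
split; [exact: pseudoSO_group | exact: rho_subgroup | exact: lambda_subgroup
  | exact: range_beta_sub |].
move=> g /pseudoSO_decomp[A [P [D [hA hD ->]]]].
exists (rho n A, beta P, lambda m D); split.
  by split=> //=; [exists A | exists P | exists D].
move=> [[_ _] _] [/= [A' _ <-] [P' _ <-] [D' _ <-]].
by move=> /rho_beta_lambda_inj[-> -> ->].
Qed.

Lemma bifactors_unique (a b : 'M[R]_(m + n)) t : B a -> B b ->
  bifactorization op HL B HR (a *m b) t -> bifactors op HL B HR a b = t.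
Proof.
move=> Ba Bb ht; have Gab : G (a *m b) by apply: pseudoSOM; exact: range_beta_sub.
have [t' [_ uniq]] := bitrans_uniq pseudoSO_bitransversal Gab.
rewrite /bifactors -(uniq _ ht); case: xgetP => [s -> hs|/(_ t)//].
by rewrite -(uniq _ hs).
Qed.

(** From [a b = X c Y], transposition gives [b a = Y^T c X^T]. Since [X] and
    [Y] commute, this equals [X^T (k c k^T) Y^T] for [k = X Y^T]. *)
Lemma bifactors_swap (a b : 'M[R]_(m + n)) : B a -> B b ->
  invmx (bifactors op HL B HR a b).1.1 = (bifactors op HL B HR b a).1.1 /\
  invmx (bifactors op HL B HR a b).2 = (bifactors op HL B HR b a).2.
Proof.
move=> Ba Bb; have Gab : G (a *m b) by apply: pseudoSOM; exact: range_beta_sub.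
have [U [P [V [hU hV e]]]] := pseudoSO_decomp Gab.
have oX := @orthogonalmx_rho R m n U hU.1; have oY := @orthogonalmx_lambda R m n V hV.1.
have OX := @pseudoO_rho R m n U hU.1; have OY := @pseudoO_lambda R m n V hV.1.
set X := rho n U in e oX OX; set Y := lambda m V in e oY OY.
rewrite (@bifactors_unique a b (X, beta P, Y)) //; last first.
  by split=> //=; [exists U | exists P | exists V].
pose k := X *m Y^T.
have hc : B (k *m beta P *m k^T).
  apply: range_beta_conj; last by exists P.
    by apply: orthogonalmxM => //; exact: orthogonalmx_tr.
  by apply: pseudoOM => //; exact: pseudoO_tr.
rewrite (@bifactors_unique b a (X^T, k *m beta P *m k^T, Y^T)) //=; last first.
  split=> //=.
  - by exists U^T; [exact: SOgroup_tr | rewrite -tr_rho].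
  - by exists V^T; [exact: SOgroup_tr | rewrite -tr_lambda].
  have sym c : B c -> c^T = c by move=> /range_betaP[_ []].
  have -> : b *m a = Y^T *m beta P *m X^T.
    rewrite -(sym _ Ba) -(sym _ Bb) -trmx_mul e !trmx_mul !mulmxA.
    by rewrite (sym (beta P)) //; exists P.
  have -> : k^T = X^T *m Y.
    by rewrite /k trmx_mul trmxK /X /Y tr_rho rho_lambdaC.
  rewrite /k !mulmxA oX mul1mx -!mulmxA.
  by rewrite (mulmx1C oY) mulmx1.
by rewrite !orthogonalmx_inv.
Qed.

Lemma pseudoSO_bigyrotransversal : bigyrotransversal op G HL B HR.
Proof.
split; first exact: pseudoSO_bitransversal.
- move=> _ b [U hU <-] hb /=; have oX := @orthogonalmx_rho R m n U hU.1.
  rewrite orthogonalmx_inv //; apply: range_beta_conj => //.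
  exact: (pseudoO_rho hU.1).
- move=> _ b [U hU <-] hb /=; have oX := @orthogonalmx_lambda R m n U hU.1.
  rewrite orthogonalmx_inv //; apply: range_beta_conj => //.
  exact: (pseudoO_lambda hU.1).
- by move=> _ _ [U _ <-] [V _ <-]; exact: rho_lambdaC.
Qed.

Lemma range_beta_twisted : twisted_subgroup op G B.
Proof.
split=> /=; first exact: range_beta_sub.
- by apply/range_betaP; split; [exact: pseudoO1 | exact: posdefmx1].
- move=> b /range_betaP[Ob pb]; apply/range_betaP; split; last exact: posdefmx_inv.
  rewrite pseudoO_inv //; do 2?apply: pseudoOM; try exact: pseudoO_sign.
  exact: pseudoO_tr.
- move=> a b /range_betaP[Oa pa] /range_betaP[Ob pb]; apply/range_betaP; split.
    by do 2?apply: pseudoOM.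
  by rewrite -{1}pa.1; apply: posdefmx_congr => //; exact: pseudoO_unit.
Qed.

End Assembly.

Theorem theorem5p1 (R : realType) (m n : nat) :
  bigyrodecomposition (mx_ops R (m + n))
    (pseudoSO R m n)
    (rho n @` SOgroup R m)
    (range (@beta R m n))
    (lambda m @` SOgroup R n).
Proof.
split.
- apply/seteqP; split=> g /=.
    move=> /pseudoSO_decomp[A [P [D [hA hD ->]]]].
    exists (rho n A), (beta P), (lambda m D).
    by split=> //; [exists A | exists P | exists D].
  move=> [_ [b [_ [[U hU <-] hb [V hV <-] ->]]]].
  apply: pseudoSOM; last exact: pseudoSO_lambda.
  by apply: pseudoSOM; [exact: pseudoSO_rho | exact: range_beta_sub].
- exact: pseudoSO_bigyrotransversal.
- exact: range_beta_twisted.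
- by move=> a b Ba Bb; exact: (bifactors_swap Ba Bb).1.
- by move=> a b Ba Bb; exact: (bifactors_swap Ba Bb).2.
Qed.
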